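(* Let $A$ be a unital $C^*$-algebra and let $p\in A$. The following conditions are equivalent: (1) $p\in\mathrm{Proj}(A)$; (2) $p\leq_\diamond\mathbf{1}$ and $\mathbf{1}-p\leq_\diamond\mathbf{1}$; (3) there is $q\in\mathrm{Proj}(A)$ such that $p\leq_\diamond q$ and $q-p\leq_\diamond q$.
   Context: $\mathbf{1}$ denotes the identity element of $A$, and $\mathrm{Proj}(A)$ the set of projections (selfadjoint idempotents) of $A$. For elements $a,b$ of a unital $C^*$-algebra $A$, the diamond relation is defined by: $a\leq_\diamond b$ if and only if $aA\subseteq bA$, $Aa\subseteq Ab$ and $aa^*a=ab^*a$. *)

(* Defs.v *)
From HB Require Import structures.
From mathcomp Require Import all_boot all_order all_algebra.
From mathcomp Require Import complex.
From mathcomp Require Import all_classical all_reals all_analysis.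

Set Implicit Arguments.
Unset Strict Implicit.
Unset Printing Implicit Defensive.

Import Order.TTheory GRing.Theory Num.Theory.
Import numFieldNormedType.Exports.

Local Open Scope classical_set_scope.
Local Open Scope complex_scope.
Local Open Scope ring_scope.

(* Unital C*-algebras over the complex numbers R[i].  The underlying Banach
   space is a [completeNormedModType R[i]], whose norm takes values in R[i]:
   there x <= y means that y - x is a nonnegative real, and norms are
   nonnegative reals.
   The product is part of the mixin because Hierarchy Builder does not allow
   a structure combining a ring with a normed module to be declared on top of
   [numDomainType], which already inherits from both; the ring structure is
   recovered below by an instance.  The case 1 = 0 (the zero algebra) is not
   excluded. *)
HB.mixin Record CompleteNormedModule_isCStarAlgebra (R : realType) A
    & CompleteNormedModule R[i] A := {
  cstar_one : A ;
  cstar_mul : A -> A -> A ;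
  star : A -> A ;
  cstar_mulA : associative cstar_mul ;
  cstar_mul1 : left_id cstar_one cstar_mul ;
  cstar_mulr1 : right_id cstar_one cstar_mul ;
  cstar_mulDl : left_distributive cstar_mul +%R ;
  cstar_mulDr : right_distributive cstar_mul +%R ;
  cstar_scaleAl : forall (k : R[i]) (a b : A),
    k *: cstar_mul a b = cstar_mul (k *: a) b ;
  cstar_scaleAr : forall (k : R[i]) (a b : A),
    k *: cstar_mul a b = cstar_mul a (k *: b) ;
  cstar_normM : forall a b : A, `|cstar_mul a b| <= `|a| * `|b| ;
  starD : forall a b : A, star (a + b) = star a + star b ;
  starZ : forall (k : R[i]) (a : A), star (k *: a) = k^* *: star a ;
  cstar_starM : forall a b : A,
    star (cstar_mul a b) = cstar_mul (star b) (star a) ;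
  starK : involutive star ;
  cstar_norm_starM : forall a : A, `|cstar_mul (star a) a| = `|a| ^+ 2
}.

#[short(type="cstarAlgType")]
HB.structure Definition CStarAlgebra (R : realType) :=
  {A of CompleteNormedModule R[i] A
      & CompleteNormedModule_isCStarAlgebra R A}.

HB.instance Definition _ (R : realType) (A : cstarAlgType R) :=
  GRing.Zmodule_isPzRing.Build (CStarAlgebra.sort A)
    (@cstar_mulA R A) (@cstar_mul1 R A) (@cstar_mulr1 R A)
    (@cstar_mulDl R A) (@cstar_mulDr R A).

Section CStarDefs.
Context {R : realType} {A : cstarAlgType R}.

Definition Proj : set A := [set p | star p = p /\ p * p = p].

Definition le_diamond (a b : A) : Prop :=
  [/\ [set a * x | x in [set: A]] `<=` [set b * x | x in [set: A]],
      [set x * a | x in [set: A]] `<=` [set x * b | x in [set: A]]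
    & a * star a * a = a * star b * a].

Lemma starM (a b : A) : star (a * b) = star b * star a.
Proof. exact: cstar_starM. Qed.

Lemma cstar_norm (a : A) : `|star a * a| = `|a| ^+ 2.
Proof. exact: cstar_norm_starM. Qed.

End CStarDefs.

Notation "a <=<> b" := (le_diamond a b)
  (at level 70, no associativity) : ring_scope.

(* Main.v *)
(* For p <=<> q and q - p <=<> q with q a projection, put s = p^*.  The last
   clauses of the two relations give p s p = p^2 and p^2 + s = p s + s p.
   Comparing the second identity with its adjoint, d = p - s satisfies
   d^2 = p^2 - p; multiplying it by p on the left, and using the first one,
   gives d^3 = 0.  Since d is skew-adjoint, the C*-identity forces d = 0, so p
   is selfadjoint and the second identity becomes p^2 + p = 2 p^2. *)

Require Import Defs.
From mathcomp Require Import all_boot all_order all_algebra.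
From mathcomp Require Import all_classical all_reals all_analysis.

Import GRing.Theory Num.Theory.

Local Open Scope classical_set_scope.
Local Open Scope ring_scope.

Section StarAlgebra.
Context {R : realType} {A : cstarAlgType R}.
Implicit Types a b p q d : A.

Lemma star0 : star (0 : A) = 0.
Proof. by apply: (addrI (star (0 : A))); rewrite -starD !addr0. Qed.

Lemma starN a : star (- a) = - star a.
Proof. by apply: (addrI (star a)); rewrite -starD !subrr star0. Qed.

Lemma starB a b : star (a - b) = star a - star b.
Proof. by rewrite starD starN. Qed.

Lemma star1 : star (1 : A) = 1.
Proof. by rewrite -[LHS]mulr1 -[X in _ * X]starK -starM mulr1 starK. Qed.

Lemma star_mul_eq0 a : star a * a = 0 -> a = 0.
Proof.
move=> aa0; apply/eqP; rewrite -normr_eq0 -sqrf_eq0.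
by rewrite -cstar_norm aa0 normr0.
Qed.

(** The C*-identity is used twice: on d^2, since (d^2)^* d^2 = d^4 = 0, and then on d, since d^* d =
    - d^2 = 0. *)
Lemma skew_cube_eq0 d : star d = - d -> d * d * d = 0 -> d = 0.
Proof.
move=> dN d3; have d2 : d * d = 0.
  by apply: star_mul_eq0; rewrite starM dN mulrNN mulrA d3 mul0r.
by apply: star_mul_eq0; rewrite dN mulNr d2 oppr0.
Qed.

Lemma Proj1 : Proj (1 : A).
Proof. by split; rewrite ?star1 ?mulr1. Qed.

Lemma Proj_compl p : Proj p -> Proj (1 - p).
Proof.
move=> [sp pp]; split; first by rewrite starB star1 sp.
by rewrite mulrBl mul1r mulrBr mulr1 pp subrr subr0.
Qed.

Lemma Proj_le_diamond1 p : Proj p -> p <=<> 1.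
Proof.
move=> [sp pp]; split.
- by move=> _ [x _ <-]; exists (p * x); rewrite ?mul1r.
- by move=> _ [x _ <-]; exists (x * p); rewrite ?mulr1.
- by rewrite sp star1 mulr1 !pp.
Qed.

(** p = p 1 lies in p A, hence in q A, on which left multiplication by the idempotent q is the
    identity. *)
Lemma le_diamond_Proj_mull {p q} : Proj q -> p <=<> q -> q * p = p.
Proof.
move=> [_ qq] [/(_ p) pA _ _]; case: pA; first by exists 1; rewrite ?mulr1.
by move=> x _ <-; rewrite mulrA qq.
Qed.

Lemma le_diamond_Proj_mulr {p q} : Proj q -> p <=<> q -> p * q = p.
Proof.
move=> [_ qq] [_ /(_ p) Ap _]; case: Ap; first by exists 1; rewrite ?mul1r.
by move=> x _ <-; rewrite -mulrA qq.
Qed.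

Lemma le_diamond_Proj_mul_star p q : Proj q -> p <=<> q ->
  p * star p * p = p * p.
Proof.
move=> qP pq; have pq' := le_diamond_Proj_mulr qP pq.
by case: pq qP => _ _ -> [-> _]; rewrite pq'.
Qed.

Lemma anticomm_star_of_le_diamond p q : Proj q -> p <=<> q -> q - p <=<> q ->
  p * p + star p = p * star p + star p * p.
Proof.
move=> qP pq [_ _]; have [sq _] := qP.
have qs : q * star p = star p.
  by rewrite -[in LHS]sq -starM (le_diamond_Proj_mulr qP pq).
have sq' : star p * q = star p.
  by rewrite -[in LHS]sq -starM (le_diamond_Proj_mull qP pq).
(* With s = p^*, the term (q - p) q (q - p) cancels from both sides and leaves (q - p) s (q - p) =
   0, which is expanded using q s = s q = s and p s p = p^2. *)
rewrite starB sq [(q - p) * (q - star p)]mulrBr.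
rewrite [(_ - (q - p) * star p) * _]mulrBl => /eqP.
rewrite -subr_eq0 addrAC subrr add0r oppr_eq0.
rewrite mulrBl qs mulrBr !mulrBl sq' -[p * star p * q]mulrA sq'.
rewrite (le_diamond_Proj_mul_star _ _ qP pq) -addrA -opprD subr_eq0 addrA.
by rewrite eq_sym subr_eq => /eqP ->; rewrite addrC.
Qed.

Lemma Proj_of_anticomm_star p : p * star p * p = p * p ->
  p * p + star p = p * star p + star p * p -> Proj p.
Proof.
move=> psp pE.
have sE : star p * star p + p = p * star p + star p * p.
  by have := congr1 star pE; rewrite !starD !starM !starK.
have d2 : (p - star p) * (p - star p) = p * p - p.
  (* The cross terms p s + s p of the square equal s^2 + p by [sE], so s^2 cancels. *)
  rewrite mulrBl !mulrBr opprB addrACA -opprD -sE.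
  by rewrite opprD addrA addrK.
have dN : star (p - star p) = - (p - star p) by rewrite starB starK opprB.
have d3 : (p - star p) * (p - star p) * (p - star p) = 0.
  (* Here p^3 + p s = p^2 s + p^2, which says exactly that (p^2 - p) (p - s) = 0. *)
  have := congr1 ( *%R p) pE; rewrite mulrDr mulrDr !mulrA psp => p3.
  by rewrite d2 mulrBl !mulrBr opprB addrACA -opprD p3 subrr.
have /eqP := skew_cube_eq0 _ dN d3; rewrite subr_eq0 => /eqP ps.
split; first by rewrite -ps.
by apply/esym/(addrI (p * p)); rewrite {3}ps pE -ps.
Qed.

End StarAlgebra.

Theorem proposition2p4 (R : realType) (A : cstarAlgType R) (p : A) :
  [<-> Proj p;
       p <=<> 1 /\ 1 - p <=<> 1;
       exists q : A, [/\ Proj q, p <=<> q & q - p <=<> q]].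
Proof.
tfae.
- by move=> pP; split; apply/Proj_le_diamond1 => //; apply: Proj_compl.
- by move=> [p1 cp1]; exists 1; split=> //; apply: Proj1.
- move=> [q [qP pq qpq]]; apply: Proj_of_anticomm_star.
    exact: le_diamond_Proj_mul_star qP pq.
  exact: anticomm_star_of_le_diamond qP pq qpq.
Qed.
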